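(* Let $m$ be a non-negative integer, let $S_m(x):=\int_{0}^{x}\sin^{2m+1}(\pi t)\,dt$ for $0\le x\le 1$, and let $\mathcal{T}_m(x):=S_m(x)/S_m(1)$ for $0\le x\le 1$. Then $\mathcal{T}_m$ is a symmetric function on $[0,1]$ such that $\mathcal{T}_m\in\Sigma_{2m+1}$.
   Context: A function $u:[a,b]\to\mathbb R$ is symmetric on $[a,b]$ if its graph is symmetric about the point $(x_M,u(x_M))$ (point reflection), where $x_M=(a+b)/2$. For a positive integer $r$, $\Sigma_r$ is the family of smooth step functions of order $r$: strictly increasing functions $\sigma:[0,1]\to[0,1]$, $\sigma\in C^\infty[0,1]$ (one-sided derivatives at endpoints), with $\sigma(0)=0$, $\sigma(1)=1$, and $\sigma^{(k)}(0)=\sigma^{(k)}(1)=0$ for $k=1,\dots,r$. *)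

(* Defs.v *)
From Stdlib Require Import Reals Lra.
From Coquelicot Require Import Coquelicot.

Open Scope R_scope.

(* A function [a, b] -> R is represented by a total f : R -> R; the predicates
   below only depend on the values of f on [a, b]. *)

(* At an interior point this is the usual derivative, at a and b it is the
   one-sided one. *)
Definition is_derive_on (a b : R) (f : R -> R) (x l : R) : Prop :=
  filterlim (fun y => (f y - f x) / (y - x))
    (within (fun y => a <= y <= b) (locally' x)) (locally l).

Definition ex_derive_on (a b : R) (f : R -> R) (x : R) : Prop :=
  exists l, is_derive_on a b f x l.

(* Meaningful only when ex_derive_on a b f x, with a < b and a <= x <= b. *)
Definition Derive_on (a b : R) (f : R -> R) (x : R) : R :=
  iota (is_derive_on a b f x).

Fixpoint Derive_n_on (a b : R) (f : R -> R) (n : nat) (x : R) : R :=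
  match n with
  | O => f x
  | S k => Derive_on a b (Derive_n_on a b f k) x
  end.

(* Continuity of every derivative on [a, b] follows from the existence of the
   next one. *)
Definition smooth_on (a b : R) (f : R -> R) : Prop :=
  forall (n : nat) (x : R), a <= x <= b ->
    ex_derive_on a b (Derive_n_on a b f n) x.

Definition strictly_increasing_on (a b : R) (f : R -> R) : Prop :=
  forall x y : R, a <= x -> x < y -> y <= b -> f x < f y.

Definition graph_on (a b : R) (u : R -> R) (p : R * R) : Prop :=
  a <= fst p <= b /\ snd p = u (fst p).

Definition point_reflection (c p : R * R) : R * R :=
  (2 * fst c - fst p, 2 * snd c - snd p).

(* The reflection is an involution, so the equivalence says that it maps the
   graph onto itself. *)
Definition symmetric_on (a b : R) (u : R -> R) : Prop :=
  let xM := (a + b) / 2 in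
  forall p : R * R,
    graph_on a b u p <-> graph_on a b u (point_reflection (xM, u xM) p).

(* The family Sigma_r, considered for r >= 1. *)
Record smooth_step (r : nat) (sigma : R -> R) : Prop := {
  smooth_step_range : forall x, 0 <= x <= 1 -> 0 <= sigma x <= 1;
  smooth_step_incr : strictly_increasing_on 0 1 sigma;
  smooth_step_smooth : smooth_on 0 1 sigma;
  smooth_step_at0 : sigma 0 = 0;
  smooth_step_at1 : sigma 1 = 1;
  smooth_step_flat : forall k : nat, (1 <= k <= r)%nat ->
    Derive_n_on 0 1 sigma k 0 = 0 /\ Derive_n_on 0 1 sigma k 1 = 0
}.

Definition Sm (m : nat) (x : R) : R :=
  RInt (fun t => sin (PI * t) ^ (2 * m + 1)) 0 x.

Definition Tm (m : nat) (x : R) : R := Sm m x / Sm m 1.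

(* Main.v *)
Require Import Defs.
From Stdlib Require Import Reals Lra Lia.
From Coquelicot Require Import Coquelicot.

Open Scope R_scope.

(** The integral defining [Sm m] makes sense on the whole line, so [Tm m] extends
    to a function on it, with derivative [sin (PI x) ^ (2 m + 1) / Sm m 1].
    Everything is read off this extension.

    Smoothness and flatness have one common cause
    ([Derive_n_Tm_sin_factor]): differentiating [sin (PI x) ^ n * h x] costs one
    power of the sine and keeps the cofactor [h] among the polynomials in
    [sin (PI x)] and [cos (PI x)].  Hence the derivative of order [k + 1] of
    [Tm m] has the form [sin (PI x) ^ (2 m + 1 - k) * h x], where the exponent
    stays 0 once it has reached 0; all derivatives exist, and those of order 1 to
    [2 m + 1] vanish at 0 and 1 because [sin (PI x)] does.
    The derivatives relative to [0, 1] are those of the extension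
    ([Derive_n_on_Derive_n]), because a limit of difference quotients restricts
    to the interval and remains unique there.

    Monotonicity holds because the integrand is positive on the open interval,
    and it gives the range.  For the symmetry, [sin (PI (1 - t)) = sin (PI t)]
    turns the integral over [0, 1 - x] into the integral over [x, 1], so that
    [Tm m x + Tm m (1 - x) = 1] ([Tm_reflect]); at [x = 1/2] this says that the
    centre of the reflection is [(1/2, 1/2)]. *)

(** * Derivatives relative to an interval *)

Lemma is_derive_on_of_is_derive (a b : R) (f g : R -> R) (x l : R) :
  a <= x <= b -> (forall y, a <= y <= b -> f y = g y) ->
  is_derive g x l -> is_derive_on a b f x l.
Proof.
  intros Hx Hfg Hg.
  apply is_derive_Reals in Hg.
  apply filterlim_locally. intros eps.
  destruct (Hg eps (cond_pos eps)) as [d Hd].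
  exists d. intros y Hy Hne Hab.
  rewrite (Hfg y Hab), (Hfg x Hx).
  assert (Hyx : y - x <> 0) by lra.
  specialize (Hd (y - x) Hyx Hy).
  rewrite Rplus_minus in Hd.
  exact Hd.
Qed.

(** Every point of a nondegenerate interval is an accumulation point of that
    interval: a short step towards the opposite half stays inside it.  This is
    what makes relative derivatives unique. *)
Lemma within_interval_proper (a b x : R) : a < b -> a <= x <= b ->
  ProperFilter' (within (fun y => a <= y <= b) (locally' x)).
Proof.
  intros Hab Hx. constructor.
  2: apply within_filter, within_filter, locally_filter.
  intros [d Hd].
  pose proof (cond_pos d) as Hd0.
  set (e := Rmin (d / 2) ((b - a) / 2)).
  assert (He0 : 0 < e) by (apply Rmin_glb_lt; lra).
  assert (He1 : e <= d / 2) by apply Rmin_l.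
  assert (He2 : e <= (b - a) / 2) by apply Rmin_r.
  destruct (Rle_dec x ((a + b) / 2)) as [Hm | Hm].
  - apply (Hd (x + e)); try lra.
    change (Rabs (x + e - x) < d). rewrite Rabs_pos_eq; lra.
  - apply (Hd (x - e)); try lra.
    change (Rabs (x - e - x) < d). rewrite Rabs_left; lra.
Qed.

Lemma Derive_on_unique (a b : R) (f : R -> R) (x l : R) :
  a < b -> a <= x <= b -> is_derive_on a b f x l -> Derive_on a b f x = l.
Proof.
  intros Hab Hx Hf.
  pose proof (within_interval_proper a b x Hab Hx) as HF.
  apply (iota_unique (V := R_CompleteNormedModule)); [| exact Hf].
  intros y Hy.
  exact (filterlim_locally_unique (V := R_NormedModule)
           (fun z => (f z - f x) / (z - x)) y l Hy Hf).
Qed.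

Lemma Derive_n_on_Derive_n (a b : R) (f : R -> R) :
  a < b -> (forall n x, ex_derive (Derive_n f n) x) ->
  forall n x, a <= x <= b -> Derive_n_on a b f n x = Derive_n f n x.
Proof.
  intros Hab Hf n. induction n as [|n IH]; intros x Hx.
  - reflexivity.
  - apply Derive_on_unique; [exact Hab | exact Hx |].
    apply (is_derive_on_of_is_derive a b _ (Derive_n f n)); [exact Hx | exact IH |].
    apply Derive_correct, Hf.
Qed.

Lemma smooth_on_of_ex_derive (a b : R) (f : R -> R) :
  a < b -> (forall n x, ex_derive (Derive_n f n) x) -> smooth_on a b f.
Proof.
  intros Hab Hf n x Hx. exists (Derive (Derive_n f n) x).
  apply (is_derive_on_of_is_derive a b _ (Derive_n f n)); [exact Hx | |].
  - apply Derive_n_on_Derive_n; assumption.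
  - apply Derive_correct, Hf.
Qed.

(** * Trigonometric polynomials *)

(** An inductive predicate on functions, rather than a type of coefficients:
    only closure under the ring operations and under differentiation matters. *)
Inductive trig_poly : (R -> R) -> Prop :=
| trig_poly_const (c : R) : trig_poly (fun _ => c)
| trig_poly_sin : trig_poly (fun x => sin (PI * x))
| trig_poly_cos : trig_poly (fun x => cos (PI * x))
| trig_poly_plus (p q : R -> R) :
    trig_poly p -> trig_poly q -> trig_poly (fun x => p x + q x)
| trig_poly_mult (p q : R -> R) :
    trig_poly p -> trig_poly q -> trig_poly (fun x => p x * q x).

Lemma trig_poly_derive (p : R -> R) : trig_poly p ->
  exists p', trig_poly p' /\ forall x, is_derive p x (p' x).
Proof.
  induction 1 as [c | | | p q _ [p' [Tp Dp]] _ [q' [Tq Dq]]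
                 | p q Hp [p' [Tp Dp]] Hq [q' [Tq Dq]]].
  - exists (fun _ => 0). split; [constructor |].
    intros x. apply (is_derive_const c x).
  - exists (fun x => PI * cos (PI * x)). split; [repeat constructor |].
    intros x. auto_derive; [exact I | ring].
  - exists (fun x => - PI * sin (PI * x)). split; [repeat constructor |].
    intros x. auto_derive; [exact I | ring].
  - exists (fun x => p' x + q' x). split; [constructor; assumption |].
    intros x. apply (is_derive_plus p q); [apply Dp | apply Dq].
  - exists (fun x => p' x * q x + p x * q' x).
    split; [repeat constructor; assumption |].
    intros x. apply (is_derive_mult p q); [apply Dp | apply Dq |].
    intros u v. apply Rmult_comm.
Qed.

(** The truncated predecessor is harmless: once no power of the sine is left,
    there is none to lose. *)
Lemma sin_pow_mult_derive (n : nat) (h : R -> R) : trig_poly h ->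
  exists h', trig_poly h' /\
    forall x, is_derive (fun y => sin (PI * y) ^ n * h y) x
                (sin (PI * x) ^ pred n * h' x).
Proof.
  intros Hh. destruct (trig_poly_derive h Hh) as [dh [Tdh Ddh]].
  destruct n as [|n].
  - exists dh. split; [exact Tdh |]. intros x. simpl.
    apply (is_derive_ext h); [intros t; symmetry; apply Rmult_1_l |].
    rewrite Rmult_1_l. apply Ddh.
  - exists (fun x => INR (S n) * (PI * cos (PI * x)) * h x + sin (PI * x) * dh x).
    split; [repeat constructor; assumption |].
    intros x.
    assert (Hs : is_derive (fun y => sin (PI * y)) x (PI * cos (PI * x)))
      by (auto_derive; [exact I | ring]).
    pose proof (is_derive_mult _ h x _ _ (is_derive_pow _ (S n) _ _ Hs) (Ddh x)
                  Rmult_comm) as Hd.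
    replace (sin (PI * x) ^ pred (S n) *
             (INR (S n) * (PI * cos (PI * x)) * h x + sin (PI * x) * dh x))
      with (plus (mult (INR (S n) * (PI * cos (PI * x)) * sin (PI * x) ^ pred (S n))
                    (h x))
              (mult (sin (PI * x) ^ S n) (dh x))).
    + exact Hd.
    + unfold plus, mult; simpl. ring.
Qed.

(** * The integral of the sine power *)

Lemma continuous_sin_pow (n : nat) (x : R) :
  continuous (fun t => sin (PI * t) ^ n) x.
Proof.
  apply (ex_derive_continuous (V := R_NormedModule)). auto_derive. exact I.
Qed.

Lemma ex_RInt_sin_pow (n : nat) (a b : R) :
  ex_RInt (fun t => sin (PI * t) ^ n) a b.
Proof.
  apply (ex_RInt_continuous (V := R_CompleteNormedModule)).
  intros z _. apply continuous_sin_pow.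
Qed.

Lemma Sm_0 (m : nat) : Sm m 0 = 0.
Proof. exact (RInt_point 0 _). Qed.

Lemma Sm_Chasles (m : nat) (x y : R) :
  Sm m x + RInt (fun t => sin (PI * t) ^ (2 * m + 1)) x y = Sm m y.
Proof. apply (RInt_Chasles (V := R_CompleteNormedModule)); apply ex_RInt_sin_pow. Qed.

Lemma is_derive_Sm (m : nat) (x : R) :
  is_derive (Sm m) x (sin (PI * x) ^ (2 * m + 1)).
Proof.
  apply (is_derive_RInt (fun t => sin (PI * t) ^ (2 * m + 1)) _ 0).
  - apply filter_forall. intros y.
    apply (RInt_correct (V := R_CompleteNormedModule)), ex_RInt_sin_pow.
  - apply continuous_sin_pow.
Qed.

Lemma Sm_incr (m : nat) : strictly_increasing_on 0 1 (Sm m).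
Proof.
  intros x y Hx Hxy Hy.
  rewrite <- (Sm_Chasles m x y).
  assert (0 < RInt (fun t => sin (PI * t) ^ (2 * m + 1)) x y); [| lra].
  apply RInt_gt_0; [exact Hxy | | intros t _; apply continuous_sin_pow].
  intros t Ht. apply pow_lt. pose proof PI_RGT_0. apply sin_gt_0; nra.
Qed.

Lemma Sm_1_pos (m : nat) : 0 < Sm m 1.
Proof. rewrite <- (Sm_0 m). apply Sm_incr; lra. Qed.

Lemma Sm_reflect (m : nat) (x : R) : Sm m x + Sm m (1 - x) = Sm m 1.
Proof.
  rewrite <- (Sm_Chasles m x 1). f_equal.
  set (g := fun t => sin (PI * t) ^ (2 * m + 1)).
  (* The substitution t = 1 - s reverses the interval, and the sign from
     swapping its endpoints cancels the factor -1. *)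
  pose proof (RInt_comp_lin (V := R_CompleteNormedModule) g (-1) 1 1 x
                (ex_RInt_sin_pow _ _ _)) as H.
  unfold Sm. fold g.
  replace (-1 * 1 + 1) with 0 in H by ring.
  replace (-1 * x + 1) with (1 - x) in H by ring.
  rewrite <- H, <- (opp_RInt_swap (V := R_CompleteNormedModule) g)
    by apply ex_RInt_sin_pow.
  rewrite <- (RInt_opp (V := R_CompleteNormedModule)) by apply ex_RInt_sin_pow.
  apply RInt_ext. intros t _. unfold g, scal, opp; simpl; unfold mult; simpl.
  replace (PI * (-1 * t + 1)) with (PI - PI * t) by ring.
  rewrite sin_PI_x. ring.
Qed.

(** * The normalised function *)

Lemma Tm_0 (m : nat) : Tm m 0 = 0.
Proof. unfold Tm. rewrite Sm_0. apply Rdiv_0_l. Qed.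

Lemma Tm_1 (m : nat) : Tm m 1 = 1.
Proof. pose proof (Sm_1_pos m). unfold Tm. field. lra. Qed.

Lemma Tm_incr (m : nat) : strictly_increasing_on 0 1 (Tm m).
Proof.
  intros x y Hx Hxy Hy. apply Rmult_lt_compat_r.
  - apply Rinv_0_lt_compat, Sm_1_pos.
  - apply Sm_incr; assumption.
Qed.

Lemma Tm_reflect (m : nat) (x : R) : Tm m (1 - x) = 1 - Tm m x.
Proof.
  pose proof (Sm_1_pos m). pose proof (Sm_reflect m x).
  unfold Tm. replace (Sm m (1 - x)) with (Sm m 1 - Sm m x) by lra.
  field. lra.
Qed.

Lemma symmetric_on_Tm (m : nat) : symmetric_on 0 1 (Tm m).
Proof.
  unfold symmetric_on. set (xM := (0 + 1) / 2).
  intros [x y]. unfold graph_on, point_reflection; simpl.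
  replace (2 * xM - x) with (1 - x) by (unfold xM; field).
  rewrite Tm_reflect.
  assert (Hc : Tm m xM = 1 / 2).
  { pose proof (Tm_reflect m xM) as H.
    replace (1 - xM) with xM in H by (unfold xM; field). lra. }
  rewrite Hc. split; intros [? ?]; split; lra.
Qed.

(** Stated with [is_derive] and not as a formula for [Derive_n (Tm m) (S k)], so
    that the same induction also yields differentiability at every order. *)
Lemma Derive_n_Tm_sin_factor (m k : nat) :
  exists h, trig_poly h /\
    forall x, is_derive (Derive_n (Tm m) k) x (sin (PI * x) ^ (2 * m + 1 - k) * h x).
Proof.
  induction k as [|k [h [Th Dh]]].
  - exists (fun _ => / Sm m 1). split; [constructor |].
    intros x. rewrite Nat.sub_0_r.
    apply (is_derive_scal_l (V := R_NormedModule) (Sm m)), is_derive_Sm.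
  - destruct (sin_pow_mult_derive (2 * m + 1 - k) h Th) as [h' [Th' Dh']].
    exists h'. split; [exact Th' |]. intros x.
    replace (2 * m + 1 - S k)%nat with (pred (2 * m + 1 - k)) by lia.
    apply (is_derive_ext (fun y => sin (PI * y) ^ (2 * m + 1 - k) * h y)).
    + intros t. symmetry. apply is_derive_unique, Dh.
    + apply Dh'.
Qed.

Lemma ex_derive_Derive_n_Tm (m n : nat) (x : R) : ex_derive (Derive_n (Tm m) n) x.
Proof.
  destruct (Derive_n_Tm_sin_factor m n) as [h [_ Dh]]. eexists. apply Dh.
Qed.

Lemma Derive_n_Tm_flat (m k : nat) (x : R) :
  (1 <= k <= 2 * m + 1)%nat -> sin (PI * x) = 0 -> Derive_n (Tm m) k x = 0.
Proof.
  intros Hk Hx. destruct k as [|k]; [lia |].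
  destruct (Derive_n_Tm_sin_factor m k) as [h [_ Dh]].
  simpl. rewrite (is_derive_unique _ _ _ (Dh x)), Hx, pow_i by lia. ring.
Qed.

Theorem theorem10 (m : nat) :
  symmetric_on 0 1 (Tm m) /\ smooth_step (2 * m + 1) (Tm m).
Proof.
  split; [apply symmetric_on_Tm |].
  pose proof (Tm_0 m) as H0. pose proof (Tm_1 m) as H1.
  pose proof (Tm_incr m) as Hincr.
  constructor; try assumption.
  - intros x [[Hx0 | <-] [Hx1 | ->]]; [| lra ..].
    pose proof (Hincr 0 x). pose proof (Hincr x 1). lra.
  - apply smooth_on_of_ex_derive; [lra | apply ex_derive_Derive_n_Tm].
  - intros k Hk.
    rewrite !Derive_n_on_Derive_n; try lra; try apply ex_derive_Derive_n_Tm.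
    split; apply Derive_n_Tm_flat; try exact Hk.
    + rewrite Rmult_0_r. apply sin_0.
    + rewrite Rmult_1_r. apply sin_PI.
Qed.
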